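(* Every Suslinian plane continuum $X\subset\mathbb R^2$ is contained in a locally connected Suslinian plane continuum $X'\subset\mathbb R^2$.
   Context: A continuum is a compact connected metric space. A space is Suslinian if every collection of pairwise disjoint non-degenerate subcontinua of it is countable. *)

(* Defs.v *)
(* The plane R^2 is modelled as R * R for an
   arbitrary R : realType (product topology = Euclidean topology). *)
From HB Require Import structures.
From mathcomp Require Import all_boot all_order all_algebra.
From mathcomp Require Import all_classical all_reals all_analysis.
Set Implicit Arguments. Unset Strict Implicit. Unset Printing Implicit Defensive.
Import Order.TTheory GRing.Theory Num.Theory.
Local Open Scope classical_set_scope.

Definition continuum {T : topologicalType} (A : set T) : Prop :=
  [/\ A !=set0, compact A & connected A].

Definition nondegenerate {T : Type} (A : set T) : Prop :=
  exists x y, [/\ A x, A y & x <> y].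

Definition suslinian {T : topologicalType} (X : set T) : Prop :=
  forall F : set (set T),
    (forall C, F C -> [/\ continuum C, nondegenerate C & C `<=` X]) ->
    (forall C D, F C -> F D -> C <> D -> C `&` D = set0) ->
    countable F.

Definition locally_connected_set {T : topologicalType} (X : set T) : Prop :=
  forall x U, X x -> nbhs x U ->
    exists V, [/\ V x, V `<=` X `&` U, connected V &
                  exists2 W, open W & V = X `&` W].

(* Main.v *)
(* Fix d > 0 smaller than the diameter of X, and let X' be the union of X and
   the boundaries of all squares that meet X in the grids of mesh d, d/2, d/4,
   ...  Away from X this is locally a finite union of segments, so X' is closed.
   If a square Q of some grid meets X, then X' intersected with Q is connected:
   a relatively clopen part P missing the boundary of Q contains no point of X,
   since its trace on X would be a clopen proper part of X; and it contains no
   point of a smaller square boundary either, since it would then contain that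
   whole boundary, which meets X because X is connected and not contained in
   the smaller square.  These small connected pieces give local connectedness
   of X' at the points of X.  Finally, let S be the set of rational multiples
   of d.  A nondegenerate subcontinuum of X' not contained in X hits S x S:
   otherwise it would miss the boundary of a small box around one of its points
   off X, when the sides of the box lie on lines with coordinates in S that are
   in none of the grids.  Only countably many disjoint sets can hit a countable
   set. *)
Require Import Defs.
From HB Require Import structures.
From mathcomp Require Import all_boot all_order all_algebra.
From mathcomp Require Import all_classical all_reals all_analysis.
From mathcomp Require Import ring lra.
Import Order.TTheory GRing.Theory Num.Theory.
Import numFieldNormedType.Exports.
Local Open Scope classical_set_scope.
Local Open Scope ring_scope.

(** * General facts on connectedness, local connectedness and countability *)

Lemma connected_clopen_sub (T : topologicalType) (A U K : set T) :
  connected A -> open U -> closed K -> A `&` U = A `&` K ->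
  A `&` U !=set0 -> A `<=` U.
Proof.
move=> cA oU cK AUK AU0.
have <- : A `&` U = A by apply: cA => //; [exists U | exists K].
exact: subIsetr.
Qed.

(** The row at height [b0] together with any one column is connected, and all these crosses share
    the point [(a0, b0)]. *)
Lemma connected_setX (S T : topologicalType) (A : set S) (B : set T) :
  connected A -> connected B -> connected (A `*` B).
Proof.
move=> cA cB.
have [[b0 Bb0]|B0] := pselect (B !=set0); last first.
  have -> : A `*` B = set0.
    by apply/seteqP; split=> // -[a b] [_ Bb]; case: B0; exists b.
  exact: connected0.
have [[a0 Aa0]|A0] := pselect (A !=set0); last first.
  have -> : A `*` B = set0.
    by apply/seteqP; split=> // -[a b] [Aa _]; case: A0; exists a.
  exact: connected0.
have row : connected ((fun a => (a, b0)) @` A).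
  apply: connected_continuous_connected => //.
  apply: continuous_subspaceT => a; apply: cvg_pair; first exact: cvg_id.
  exact: cvg_cst.
have column a : connected (pair a @` B).
  apply: connected_continuous_connected => //.
  apply: continuous_subspaceT => b; apply: cvg_pair; last exact: cvg_id.
  exact: cvg_cst.
have -> : A `*` B =
    \bigcup_(a in A) ((fun a => (a, b0)) @` A `|` pair a @` B).
  apply/seteqP; split=> [[a b] [/= Aa Bb]|].
    by exists a => //; right; exists b.
  by move=> _ [a Aa [[a' Aa' <-]|[b Bb <-]]].
apply: bigcup_connected.
  by exists (a0, b0) => a Aa; left; exists a0.
move=> a Aa; apply: connectedU => //.
by exists (a, b0); split; [exists a | exists b0].
Qed.

(** The hypothesis is connectedness im kleinen at every point: [N] contains a relative neighbourhood
    of [x] but may fail to be relatively open. Around each point of a component of [X] in an open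
    set such an [N] stays inside the component, so the component is relatively open. *)
Lemma locally_connected_of_im_kleinen (T : topologicalType) (X : set T) :
  (forall x U, X x -> open U -> U x ->
    exists N W, [/\ N `<=` X `&` U, N x, connected N, open W & W x /\ X `&` W `<=` N]) ->
  locally_connected_set X.
Proof.
move=> H x U Xx /nbhs_interior; rewrite nbhsE => -[U0 [oU0 U0x] U0U].
have {}U0U : U0 `<=` U by move=> y /U0U; apply: nbhs_singleton.
pose V := connected_component (X `&` U0) x.
have VXU : V `<=` X `&` U0 := @connected_component_sub _ _ _.
exists V; split.
- exact: connected_component_refl.
- by move=> y /VXU[Xy /U0U].
- exact: component_connected.
exists (\bigcup_(W in [set W | open W /\ X `&` W `<=` V]) W).
  by apply: bigcup_open => W [].
apply/seteqP; split=> [y Vy|y [Xy [W [_ XWV] Wy]]]; last exact: XWV.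
have [Xy U0y] := VXU _ Vy; split=> //.
have [N [W [NX Ny cN oW [Wy XWN]]]] := H y U0 Xy oU0 U0y.
exists W => //; split=> // z /XWN Nz.
apply: connected_component_trans Vy _.
exact: (connected_component_max Ny NX cN).
Qed.

Lemma countable_disjoint_meeting (T : Type) (D : set T) (F : set (set T)) :
  countable D -> (forall C, F C -> C `&` D !=set0) ->
  (forall C C', F C -> F C' -> C <> C' -> C `&` C' = set0) -> countable F.
Proof.
move=> cD FD dF.
(* [g] sends [x] to the member of [F] through [x], unique by disjointness; [set0] is the default
   when there is none. Every member of [F] is a value of [g] on [D]. *)
pose g (x : T) := xget set0 [set C | F C /\ C x].
apply: (@sub_countable _ _ _ (g @` D)); last exact: card_le_trans (card_image_le _ _) cD.
apply: subset_card_le => C FC; have [x [Cx Dx]] := FD _ FC.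
exists x => //; rewrite /g; case: xgetP => [C' _ [FC' C'x]|/(_ C)[]//].
apply: contrapT => CC'.
by have : (C' `&` C) x; [|rewrite (dF _ _ FC' FC CC')].
Qed.

(** * Dyadic grids on the line *)

Section Grid.
Context {R : realType}.
Implicit Types (d x y : R) (n : nat).

Definition mesh d n : R := d / 2 ^+ n.

Definition grid d n : set R := [set a | exists k : int, a = k%:~R * mesh d n].

Lemma mesh_gt0 {d} n : 0 < d -> 0 < mesh d n.
Proof. by move=> d0; rewrite divr_gt0// exprn_gt0. Qed.

Lemma mesh_le {d} n : 0 < d -> mesh d n <= d.
Proof.
by move=> d0; rewrite ler_pdivrMr ?exprn_gt0// ler_peMr ?(ltW d0)// exprn_ege1// ler1n.
Qed.

Lemma mesh_small {d x} : 0 < d -> 0 < x -> exists n, mesh d n < x.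
Proof.
move=> d0 x0; have [m dm] : exists m : nat, d / x < m%:R.
  by exists (Num.bound (d / x)); rewrite archi_boundP// divr_ge0 ?ltW.
exists m; rewrite /mesh ltr_pdivrMr ?exprn_gt0// mulrC -ltr_pdivrMr//.
by apply: lt_trans dm _; rewrite -natrX ltr_nat ltn_expl.
Qed.

Lemma grid_mono {d m n} : (m <= n)%N -> grid d m `<=` grid d n.
Proof.
move=> /subnK mn _ [k ->]; exists (k * 2 ^+ (n - m)).
rewrite /mesh -{2}mn intrM rmorphXn /= exprD.
have ? : (2 ^+ m : R) != 0 by rewrite expf_neq0.
have ? : (2 ^+ (n - m) : R) != 0 by rewrite expf_neq0.
by field; apply/andP.
Qed.

Lemma mesh_anti {d m n} : 0 < d -> (m <= n)%N -> mesh d n <= mesh d m.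
Proof.
move=> d0 mn; rewrite ler_pM2l// lef_pV2 ?posrE ?exprn_gt0//.
by rewrite ler_weXn2l// ler1n.
Qed.

Lemma grid_succ {d n a} : grid d n a -> grid d n (a + mesh d n).
Proof. by move=> [k ->]; exists (k + 1); rewrite intrD mulrDl mul1r. Qed.

Lemma grid_gap {d n a b} : 0 < d -> grid d n a -> grid d n b -> a < b ->
  a + mesh d n <= b.
Proof.
move=> d0 [k ->] [l ->]; have h0 := mesh_gt0 n d0.
rewrite ltr_pM2r// ltr_int -lezD1 -(ler_int R) intrD => kl.
by rewrite -{2}[mesh d n]mul1r -mulrDl ler_pM2r.
Qed.

Lemma grid_floor {d} n x : 0 < d -> exists2 a, grid d n a & a <= x < a + mesh d n.
Proof.
move=> d0; have h0 := mesh_gt0 n d0.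
exists ((Num.floor (x / mesh d n))%:~R * mesh d n); first by eexists.
have /andP[] := floor_itv (x / mesh d n).
rewrite ler_pdivlMr// ltr_pdivrMr// => -> /=.
by rewrite intrD mulrDl mul1r.
Qed.

(** The radius is the distance from [x] to the nearest grid point other than [x]. *)
Lemma grid_isolated {d} n x : 0 < d ->
  exists2 e, 0 < e & forall a, grid d n a -> `|x - a| < e -> a = x.
Proof.
move=> d0; have h0 := mesh_gt0 n d0.
have [a ga /andP[ax xa]] := grid_floor n x d0.
have far b : grid d n b -> b != a -> b <= a - mesh d n \/ a + mesh d n <= b.
  move=> gb; rewrite neq_lt => /orP[ba|ab]; [left|right].
    by rewrite lerBrDr; exact: (grid_gap d0 gb ga).
  exact: (grid_gap d0 ga gb).
have [ax'|xa'] := eqVneq a x.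
  exists (mesh d n) => // b gb; rewrite ltr_norml => /andP[? ?].
  have [->//|/(far _ gb)[]] := eqVneq b a; subst; lra.
have {}ax : a < x by rewrite lt_neqAle xa'.
exists (Num.min (x - a) (a + mesh d n - x)); first by rewrite lt_min; lra.
move=> b gb; rewrite lt_min !ltr_norml => /andP[/andP[? ?] /andP[? ?]].
have [|/(far _ gb)[]] := eqVneq b a; lra.
Qed.

(** No grid point other than [x] is within [e] of [x], so none lies strictly on the far side of [x]
    up to [y]. Hence equalities and weak inequalities with grid points pass from [y] to [x]; strict
    ones need not. *)
Lemma grid_snap {d} n x : 0 < d ->
  exists2 e, 0 < e & forall a y, grid d n a -> `|x - y| < e ->
    [/\ a = y -> a = x, a <= y -> a <= x & y <= a -> x <= a].
Proof.
move=> d0; have [e e0 iso] := grid_isolated n x d0.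
exists e => // a y ga xy.
have gt_x : x < a -> y < a.
  move=> xa; rewrite ltNge; apply/negP => ay.
  suff ax : a = x by rewrite ax ltxx in xa.
  by apply: iso => //; move: xy; rewrite !ltr_norml; lra.
have lt_x : a < x -> a < y.
  move=> xa; rewrite ltNge; apply/negP => ay.
  suff ax : a = x by rewrite ax ltxx in xa.
  by apply: iso => //; move: xy; rewrite !ltr_norml; lra.
split.
- by move=> ay; apply: iso => //; rewrite ay.
- by move=> ay; rewrite leNgt; apply/negP => /gt_x; rewrite ltNge ay.
- by move=> ay; rewrite leNgt; apply/negP => /lt_x; rewrite ltNge ay.
Qed.

Lemma grid_dense {d x y} : 0 < d -> x < y ->
  exists2 a, (exists q : rat, a = d * ratr q) &
  x < a < y /\ forall n, ~ grid d n a.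
Proof.
(* The multiples of mesh d n shifted by a third of it are in no grid. *)
move=> d0 xy;
have [n hn] : exists n, mesh d n < (y - x) / 2.
  by apply: mesh_small => //; lra.
have h0 := mesh_gt0 n d0; have [a [k ->] ax] := grid_floor n x d0.
(* The summand 1 carries the grid point below [x] past [x]; the total shift of 4/3 mesh stays below
   [y - x]. *)
exists ((k%:~R + 1 + 1/3%:R) * mesh d n).
  exists ((k%:~R + 1 + 1/3%:R) / 2 ^+ n).
  rewrite /mesh fmorph_div /= rmorphXn /= !rmorphD /= ratr_int fmorph_div /=.
  by rewrite !ratr_nat rmorph1 mulrCA.
split; first by rewrite !mulrDl; lra.
move=> m [l].
(* Clearing denominators gives [(3k + 4) 2^m = 3 l 2^n] in the integers, which is impossible modulo
   3. *)
rewrite /mesh => /(congr1 (fun t => t * (3%:R * 2 ^+ m * 2 ^+ n) / d)).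
have d00 : d != 0 by rewrite gt_eqF.
have ? : (2 ^+ m : R) != 0 by rewrite expf_neq0.
have ? : (2 ^+ n : R) != 0 by rewrite expf_neq0.
rewrite (_ : _ / d = (3%:R * k%:~R + 4%:R) * 2 ^+ m); last by field; apply/andP.
rewrite (_ : _ / d = 3%:R * l%:~R * 2 ^+ n); last by field; apply/andP.
move=> E; have {E}/eqP : ((3 * k + 4) * 2 ^+ m)%:~R = (3 * l * 2 ^+ n)%:~R :> R.
  by rewrite !intrM intrD !rmorphXn /= !intrM.
rewrite eqr_int => /eqP E.
have : (3 %| (3 * k + 4) * 2 ^+ m)%Z by rewrite E -mulrA dvdz_mulr.
rewrite Gauss_dvdzl ?coprimezXr//.
by rewrite rpredDl ?dvdz_mulr.
Qed.

End Grid.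

(** * Squares, their boundaries, and rectangles in the plane *)

Lemma open_setX (S T : topologicalType) (A : set S) (B : set T) :
  open A -> open B -> open (A `*` B).
Proof.
move=> oA oB; have -> : A `*` B = fst @^-1` A `&` snd @^-1` B by [].
by apply: openI; apply: open_comp => // x _; [exact: cvg_fst | exact: cvg_snd].
Qed.

Lemma closed_setX (S T : topologicalType) (A : set S) (B : set T) :
  closed A -> closed B -> closed (A `*` B).
Proof.
move=> cA cB; have -> : A `*` B = fst @^-1` A `&` snd @^-1` B by [].
by apply: closedI; apply: closed_comp => // x _; [exact: cvg_fst | exact: cvg_snd].
Qed.

Section Squares.
Context {R : realType}.
Implicit Types (c p z : R * R) (d h : R) (X : set (R * R)).

Lemma ball_pairE p r z :
  ball p r z = (`|p.1 - z.1| < r /\ `|p.2 - z.2| < r) :> Prop.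
Proof. by rewrite /ball /= /prod_ball /= -ball_normE. Qed.

Definition square c h : set (R * R) := `[c.1, c.1 + h] `*` `[c.2, c.2 + h].

Definition open_square c h : set (R * R) := `]c.1, c.1 + h[ `*` `]c.2, c.2 + h[.

Definition frame c h := square c h `\` open_square c h.

Lemma squareE c h z :
  square c h z = (c.1 <= z.1 <= c.1 + h /\ c.2 <= z.2 <= c.2 + h) :> Prop.
Proof. by rewrite /square /= !in_itv. Qed.

Lemma open_squareE c h z :
  open_square c h z = (c.1 < z.1 < c.1 + h /\ c.2 < z.2 < c.2 + h) :> Prop.
Proof. by rewrite /open_square /= !in_itv. Qed.

Lemma frameP c h z : frame c h z <-> square c h z /\
  [\/ z.1 = c.1, z.1 = c.1 + h, z.2 = c.2 | z.2 = c.2 + h].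
Proof.
rewrite /frame /= open_squareE squareE; split=> [[sz nz]|[sz ez]]; split=> //.
  apply: contrapT => ez; apply: nz; move: sz => [/andP[a1 b1] /andP[a2 b2]].
  rewrite !lt_neqAle a1 b1 a2 b2 !andbT.
  by split; apply/andP; split; apply/eqP => e; apply: ez;
    [constructor 1|constructor 2|constructor 3|constructor 4].
by case: ez => ->; lra.
Qed.

Lemma closed_square c h : closed (square c h).
Proof. by apply: closed_setX; exact: itv_closed. Qed.

Lemma open_open_square c h : open (open_square c h).
Proof. by apply: open_setX; exact: itv_open. Qed.

Lemma open_square_sub c h : open_square c h `<=` square c h.
Proof. by move=> z; rewrite open_squareE squareE; lra. Qed.

(** The left and bottom sides share the corner [c], the right and top sides share the opposite
    corner, and these two L shapes meet at the top left corner. *)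
Lemma connected_frame c h : 0 <= h -> connected (frame c h).
Proof.
move=> h0.
pose V a : set (R * R) := [set a] `*` `[c.2, c.2 + h].
pose H b : set (R * R) := `[c.1, c.1 + h] `*` [set b].
have -> : frame c h = (V c.1 `|` H c.2) `|` (V (c.1 + h) `|` H (c.2 + h)).
  apply/seteqP; split=> [z /frameP[[z1 z2]]|].
    case=> e; [left; left|right; left|left; right|right; right]; split=> //.
  move=> [x y]; rewrite frameP squareE /V /H /= !in_itv /=.
  move=> [[[-> ?]|[? ->]]|[[-> ?]|[? ->]]]; (split; [lra|]).
  - by constructor 1.
  - by constructor 3.
  - by constructor 2.
  - by constructor 4.
have cV a : connected (V a).
  by apply: connected_setX; [exact: connected1|exact: segment_connected].
have cH a : connected (H a).
  by apply: connected_setX; [exact: segment_connected|exact: connected1].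
apply: connectedU.
- exists (c.1, c.2 + h); split; [left|right].
    by rewrite /V /= in_itv /=; lra.
  by rewrite /H /= in_itv /=; lra.
- apply: connectedU => //; exists c.
  by rewrite /V /H /= !in_itv /=; lra.
- apply: connectedU => //; exists (c.1 + h, c.2 + h).
  by rewrite /V /H /= !in_itv /=; lra.
Qed.

(** If [X] missed the frame, the open and the closed square would cut out the same part of [X],
    which would be relatively clopen. *)
Lemma frame_meets X c h : connected X -> X `&` square c h !=set0 ->
  ~ X `<=` square c h -> X `&` frame c h !=set0.
Proof.
move=> cX XQ nXQ; apply: contrapT => XF; apply: nXQ.
have XE : X `&` open_square c h = X `&` square c h.
  apply/seteqP; split=> z [Xz zQ]; split=> //; first exact: open_square_sub.
  by apply: contrapT => zO; apply: XF; exists z.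
apply: subset_trans (@open_square_sub c h).
apply: (connected_clopen_sub _ _ _ _ cX (open_open_square c h) (closed_square c h)) => //.
by rewrite XE.
Qed.

(** A connected set joining [p] to [z]; it is a segment when they share a coordinate, and can then
    lie inside a frame. *)
Definition rectangle p z : set (R * R) :=
  `[Num.min p.1 z.1, Num.max p.1 z.1] `*` `[Num.min p.2 z.2, Num.max p.2 z.2].

Lemma rectangleP p z t : rectangle p z t <->
  (p.1 <= t.1 <= z.1 \/ z.1 <= t.1 <= p.1) /\ (p.2 <= t.2 <= z.2 \/ z.2 <= t.2 <= p.2).
Proof.
rewrite /rectangle /= !in_itv /=.
by case: (leP p.1 z.1); case: (leP p.2 z.2); split; lra.
Qed.

Lemma connected_rectangle p z : connected (rectangle p z).
Proof. by apply: connected_setX; exact: segment_connected. Qed.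

Lemma rectangle_l p z : rectangle p z p.
Proof. by apply/rectangleP; lra. Qed.

Lemma rectangle_r p z : rectangle p z z.
Proof. by apply/rectangleP; lra. Qed.

Lemma rectangle_ball p z r : ball p r z -> rectangle p z `<=` ball p r.
Proof.
rewrite ball_pairE !ltr_norml => pz t /rectangleP.
by rewrite ball_pairE !ltr_norml; lra.
Qed.

End Squares.

(** * The net around [X] and its local structure off [X] *)

Section Net.
Context {R : realType}.
Context (d : R) (X : set (R * R)) (d_gt0 : 0 < d).
Implicit Types (c p z : R * R) (n m : nat).

Let h := @mesh R d.
Let h_gt0 n : 0 < h n. Proof. exact: mesh_gt0. Qed.

Definition vertex n c := grid d n c.1 /\ grid d n c.2.

Definition meeting n c := vertex n c /\ X `&` square c (h n) !=set0.

Definition net : set (R * R) :=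
  X `|` [set z | exists n c, meeting n c /\ frame c (h n) z].

Lemma frame_net n c : meeting n c -> frame c (h n) `<=` net.
Proof. by move=> nc z cz; right; exists n, c. Qed.

Lemma square_cover n z : exists2 c, vertex n c & square c (h n) z.
Proof.
have [a ga az] := grid_floor n z.1 d_gt0.
have [b gb bz] := grid_floor n z.2 d_gt0.
by exists (a, b); rewrite ?squareE /vertex //=; rewrite /h; lra.
Qed.

(** If [m <= n], the sides of the square at [c'] lie on lines of grid [n], which never enter an open
    square of that grid, so the hypotheses conflict. Otherwise grid [n] lies in grid [m], and two
    squares of nested grids whose interiors overlap are nested. *)
Lemma square_nested n m c c' z : vertex n c -> vertex m c' ->
  frame c' (h m) z -> open_square c (h n) z -> square c' (h m) `<=` square c (h n).
Proof.
move=> [gc1 gc2] [gc1' gc2'] /frameP[].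
rewrite squareE open_squareE => z' ez zo.
have gap a : grid d n a ->
    (a <= c.1 \/ c.1 + h n <= a) /\ (a <= c.2 \/ c.2 + h n <= a).
  move=> ga; split.
    by case: (leP a c.1) => [|/(grid_gap d_gt0 gc1 ga)]; [left|right].
  by case: (leP a c.2) => [|/(grid_gap d_gt0 gc2 ga)]; [left|right].
have [mn|/ltnW nm] := leqP m n.
  have := gap _ (grid_mono mn _ gc1').
  have := gap _ (grid_mono mn _ (grid_succ gc1')).
  have := gap _ (grid_mono mn _ gc2').
  have := gap _ (grid_mono mn _ (grid_succ gc2')).
  by rewrite -/(h m); case: ez => ez; lra.
have up a b : grid d n a -> grid d m b -> b < a + h n -> b + h m <= a + h n.
  move=> ga gb; apply: grid_gap => //; apply: grid_mono nm _ _.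
  exact: grid_succ.
have low a b : grid d n a -> grid d m b -> a < b + h m -> a + h m <= b + h m.
  move=> ga gb; apply: grid_gap => //; first exact: grid_mono nm _ _.
  exact: grid_succ.
have := (up _ _ gc1 gc1', up _ _ gc2 gc2', low _ _ gc1 gc1', low _ _ gc2 gc2').
move=> [[[/(_ _)u1 /(_ _)u2] /(_ _)l1] /(_ _)l2].
have {}u1 := u1 ltac:(lra); have {}u2 := u2 ltac:(lra).
have {}l1 := l1 ltac:(lra); have {}l2 := l2 ltac:(lra).
by move=> t; rewrite !squareE; lra.
Qed.

(** All grids of level at most [n] lie in grid [n], so one radius from [grid_snap] serves them all.
    If [z] is on a side, [p] is on the same side and the rectangle is a segment of it. *)
Lemma near_square n p : exists2 e, 0 < e & forall m c z, (m <= n)%N -> vertex m c ->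
  ball p e z -> square c (h m) z ->
  square c (h m) p /\ (frame c (h m) z -> rectangle p z `<=` frame c (h m)).
Proof.
have [e1 e10 snap1] := grid_snap n p.1 d_gt0.
have [e2 e20 snap2] := grid_snap n p.2 d_gt0.
exists (Num.min e1 e2); first by rewrite lt_min e10.
move=> m c z mn [gm1 gm2].
have [gc1 gc1'] := (grid_mono mn _ gm1, grid_mono mn _ (grid_succ gm1)).
have [gc2 gc2'] := (grid_mono mn _ gm2, grid_mono mn _ (grid_succ gm2)).
rewrite ball_pairE !lt_min => -[/andP[pz1 _] /andP[_ pz2]].
have [eq1 le1 _] := snap1 _ _ gc1 pz1; have [eq1' _ ge1'] := snap1 _ _ gc1' pz1.
have [eq2 le2 _] := snap2 _ _ gc2 pz2; have [eq2' _ ge2'] := snap2 _ _ gc2' pz2.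
rewrite squareE => -[/andP[cz1 zc1] /andP[cz2 zc2]].
have [cp1 pc1] := (le1 cz1, ge1' zc1); have [cp2 pc2] := (le2 cz2, ge2' zc2).
rewrite squareE cp1 pc1 cp2 pc2; split=> // /frameP[_ ez] t /rectangleP[t1 t2].
have between (x y u a b : R) : a <= x -> x <= b -> a <= y -> y <= b ->
    x <= u <= y \/ y <= u <= x -> a <= u <= b.
  move=> ax xb ay yb [] /andP[l r]; apply/andP.
    by split; [exact: le_trans l|exact: le_trans yb].
  by split; [exact: le_trans l|exact: le_trans xb].
have squeeze (x y u a : R) : a = x -> y = a -> x <= u <= y \/ y <= u <= x -> u = a.
  move=> -> -> xu; apply: le_anti.
  by rewrite andbC; case: xu.
apply/frameP; rewrite squareE; split.
  by split; [exact: between t1|exact: between t2].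
case: ez => ez.
- by constructor 1; apply: squeeze t1 => //; exact: eq1.
- by constructor 2; apply: squeeze t1 => //; exact: eq1'.
- by constructor 3; apply: squeeze t2 => //; exact: eq2.
- by constructor 4; apply: squeeze t2 => //; exact: eq2'.
Qed.

(** Off [X] only finitely many levels matter: a square of side below [r0 / 2] that meets [X] and
    comes within [r0 / 2] of [p] would put a point of [X] within [r0] of [p]. Since the rectangle
    contains [p], this serves both closedness and local connectedness. *)
Lemma net_rectangle p r : closed X -> ~ X p -> 0 < r ->
  exists2 e, 0 < e <= r & forall z, ball p e z -> net z -> rectangle p z `<=` net.
Proof.
move=> clX Xp r_gt0.
have [r0 r0_gt0 XB] : exists2 r0, 0 < r0 & forall z, ball p r0 z -> ~ X z.
  have /nbhs_ballP[r0 r00 B] : nbhs p (~` X).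
    by apply: open_nbhs_nbhs; split=> //; exact: closed_openC.
  by exists r0.
have [n hn] : exists n, h n < r0 / 2 by apply: mesh_small => //; lra.
have [e e_gt0 near] := near_square n p.
exists (Num.min e (Num.min r (r0 / 2))).
  by rewrite !lt_min !ge_min lexx e_gt0 r_gt0 orbT /= andbT; lra.
move=> z; rewrite ball_pairE !lt_min => -[/and3P[pe1 _ pr1] /and3P[pe2 _ pr2]].
have pe : ball p e z by rewrite ball_pairE.
case=> [Xz|[m [c [[vc [x [Xx xQ]]] cz]]]].
  by case: (XB z) => //; rewrite ball_pairE; lra.
have zQ : square c (h m) z by case/frameP: cz.
have [nm|/ltnW mn] := leqP n m.
  have hmn : h m <= h n by exact: mesh_anti d_gt0 nm.
  case: (XB x) => //; rewrite ball_pairE.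
  by move: pr1 pr2 zQ xQ; rewrite !squareE !ltr_norml; lra.
have [_ /(_ cz) sub] := near m c z mn vc pe zQ.
by move=> t /sub; apply: frame_net; split=> //; exists x.
Qed.

Lemma closed_net : closed X -> closed net.
Proof.
move=> clX; rewrite -openC openE => p np.
have [//|e /andP[e0 _] H] := @net_rectangle p 1 clX _ ltr01.
  by move=> Xp; apply: np; left.
apply/nbhs_ballP; exists e => // z pz nz; apply: np.
exact: H pz nz _ (rectangle_l _ _).
Qed.

(** * Connectedness, local connectedness and compactness of the net *)

Context (X_connected : connected X)
  (X_large : forall c e, e <= d -> ~ X `<=` square c e).

Lemma connected_net_square n c : closed X -> meeting n c ->
  connected (net `&` square c (h n)).
Proof.
move=> clX nc.
have h_le m : h m <= d by exact: mesh_le.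
have FA m c' : meeting m c' -> frame c' (h m) `<=` net `&` square c' (h m).
  by move=> mc z cz; split; [exact: frame_net cz|by case/frameP: cz].
have key U K : open U -> closed K ->
    net `&` square c (h n) `&` U = net `&` square c (h n) `&` K ->
    frame c (h n) `&` U = set0 -> net `&` square c (h n) `&` U = set0.
  move=> oU cK UK FU; apply/seteqP; split=> // z [[nz zQ] Uz].
  have UE t : net t -> square c (h n) t -> U t <-> K t.
    move=> nt tQ; have /seteqP[S1 S2] := UK.
    by split=> ?; [case: (S1 t) | case: (S2 t)].
  have XU : X `&` square c (h n) `&` U = set0.
    apply/seteqP; split=> // t [[Xt tQ] Ut].
    apply: (X_large c (h n)) => //.
    apply: subset_trans (@open_square_sub _ c (h n)).
    apply: subset_trans (@subIsetl _ _ U).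
    (* [U] is cut down to the open square and [K] to the closed one; their traces on [X] agree
       because [U] misses the frame. *)
    apply: (connected_clopen_sub _ _ _ (square c (h n) `&` K)) => //.
    - by apply: openI => //; exact: open_open_square.
    - by apply: closedI => //; exact: closed_square.
    - apply/seteqP; split=> y [Xy [yQ yU]]; split=> //.
        have yQ' := open_square_sub _ _ _ yQ; split=> //.
        by apply/UE => //; left.
      have Uy : U y by apply/UE => //; left.
      split=> //; apply: contrapT => yO.
      by have : (frame c (h n) `&` U) y; [|rewrite FU].
    - exists t; split=> //; split=> //; apply: contrapT => tO.
      by have : (frame c (h n) `&` U) t; [|rewrite FU].
  have zO : open_square c (h n) z.
    apply: contrapT => zO.
    by have : (frame c (h n) `&` U) z; [|rewrite FU].
  case: nz => [Xz|[m [c' [mc' c'z]]]].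
    by have : (X `&` square c (h n) `&` U) z; [|rewrite XU].
  (* The frame through [z] enters the open square, so it lies in the part of the net where [U] and
     [K] agree. *)
  have sub : square c' (h m) `<=` square c (h n).
    by apply: square_nested c'z zO; [case: nc|case: mc'].
  have FUsub : frame c' (h m) `<=` U.
    have cF : connected (frame c' (h m)) by apply: connected_frame; exact: ltW.
    apply: (connected_clopen_sub _ _ _ K cF) => //; last by exists z.
    by apply/seteqP; split=> t [Ft Ht]; split=> //;
      have [/= nt /sub tQ] := FA _ _ mc' _ Ft;
      apply/UE.
  have [x [Xx xF]] : X `&` frame c' (h m) !=set0.
    by apply: frame_meets => //; [case: mc'|exact: X_large].
  have : (X `&` square c (h n) `&` U) x.
    by split; [split=> //; apply: sub; case/frameP: xF|exact: FUsub].
  by rewrite XU.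
move=> E E0 [U oU EU] [K cK EK].
have cF : connected (frame c (h n)) by apply: connected_frame; exact: ltW.
have [FU0|/set0P FU0] := eqVneq (frame c (h n) `&` U) set0.
  by move: E0; rewrite EU (key U K) -?EU// => -[].
have FU : frame c (h n) `<=` U.
  apply: (connected_clopen_sub _ _ _ K cF) => //.
  have /seteqP[S1 S2] :
      net `&` square c (h n) `&` U = net `&` square c (h n) `&` K by rewrite -EU.
  by apply/seteqP; split=> t [Ft Ht]; split=> //; [case: (S1 t)|case: (S2 t)];
    move=> //; split=> //; exact: FA.
(* [E] contains the whole frame, so its relative complement misses the frame and is empty by [key],
   with the complements of [K] and [U] as the open and the closed set. *)
have C0 : net `&` square c (h n) `&` ~` K = set0.
  have clA : net `&` square c (h n) `&` ~` K = net `&` square c (h n) `&` ~` U.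
    have /seteqP[S1 S2] :
      net `&` square c (h n) `&` U = net `&` square c (h n) `&` K by rewrite -EU.
    by apply/seteqP; split=> t [At Ht]; split=> // Wt; apply: Ht;
      [case: (S1 t)|case: (S2 t)].
  apply: (key _ (~` U)) => //; [exact: closed_openC|exact: open_closedC|].
  apply/seteqP; split=> // t [Ft]; apply.
  have : (net `&` square c (h n) `&` U) t by split; [exact: FA|exact: FU].
  by rewrite -EU EK => -[].
apply/seteqP; split=> [t|t At]; first by rewrite EU => -[].
rewrite EK; split=> //; apply: contrapT => Kt.
by have : (net `&` square c (h n) `&` ~` K) t; [|rewrite C0].
Qed.

(** No square of the net contains [X], so each frame meets [X], and the sets [X] plus one frame are
    connected with a common point. *)
Lemma connected_net : X !=set0 -> connected net.
Proof.
move=> [x Xx].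
have -> : net = \bigcup_(A in [set X] `|`
    [set X `|` frame nc.2 (h nc.1) | nc in [set nc | meeting nc.1 nc.2]]) A.
  apply/seteqP; split=> z.
    case=> [Xz|[n [c [nc cz]]]]; first by exists X => //; left.
    by exists (X `|` frame c (h n)); [right; exists (n, c)|right].
  move=> [_ [->|[[n c] /= nc <-]]]; first by left.
  by case; [left|exact: frame_net].
apply: bigcup_connected; first by exists x => _ [->//|[nc _ <-]]; left.
move=> _ [->//|[[n c] /= nc <-]]; apply: connectedU => //.
  by apply: frame_meets => //; [case: nc|apply: X_large; exact: mesh_le].
by apply: connected_frame; exact: ltW.
Qed.

Lemma locally_connected_net : closed X -> locally_connected_set net.
Proof.
move=> clX; apply: locally_connected_of_im_kleinen => p U np oU Up.
have [r r0 pU] : exists2 r, 0 < r & ball p r `<=` U.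
  have /nbhs_ballP[r r0 pU] : nbhs p U by exact: open_nbhs_nbhs.
  by exists r.
have [Xp|Xp] := pselect (X p).
  (* Every level [n] square coming within [e] of [p] contains [p]. Hence the pieces of the net in
     the squares through [p] cover a relative neighbourhood of [p], and they all share [p]. *)
  have [n hn] : exists n, h n < r by exact: mesh_small.
  have [e e0 near] := near_square n p.
  pose S := [set c | vertex n c /\ square c (h n) p].
  have Smeet c : S c -> meeting n c by move=> [vc cp]; split=> //; exists p.
  exists (\bigcup_(c in S) (net `&` square c (h n))), (ball p e); split.
  - move=> z [c [vc cp] [nz cz]]; split=> //; apply: pU.
    by move: cp cz; rewrite ball_pairE !squareE !ltr_norml; lra.
  - by have [c vc cp] := square_cover n p; exists c.
  - apply: bigcup_connected; first by exists p => c [].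
    by move=> c /Smeet; exact: connected_net_square.
  - exact: ball_open.
  split; first exact: ballxx.
  move=> z [nz pz]; have [c vc cz] := square_cover n z.
  by exists c => //; split=> //; have [] := near n c z (leqnn n) vc pz cz.
(* Off [X], the net near [p] is a union of rectangles with corner [p]. *)
have [e /andP[e0 er] H] := @net_rectangle p r clX Xp r0.
exists (net `&` ball p e), (ball p e); split=> //.
- by move=> z [nz pz]; split=> //; apply: pU; exact: le_ball pz.
- by split=> //; exact: ballxx.
- have -> : net `&` ball p e = \bigcup_(z in net `&` ball p e) rectangle p z.
    apply/seteqP; split=> [z zN|t [z [nz pz] zt]].
      by exists z => //; exact: rectangle_r.
    by split; [exact: H zt|exact: rectangle_ball zt].
  apply: bigcup_connected; first by exists p => z _; exact: rectangle_l.
  by move=> z _; exact: connected_rectangle.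
- exact: ball_open.
- by split=> //; exact: ballxx.
Qed.

Lemma compact_net : compact X -> compact net.
Proof.
move=> cX; have clX : closed X by apply: compact_closed cX; exact: norm_hausdorff.
have [M [_ /(_ (M + 1))]] := compact_bounded cX.
rewrite ltrDl => /(_ ltr01) XM; set B := M + 1 in XM.
(* Each frame bounds a square of side at most [d] containing a point of [X], so it leaves the box of
   half-side [B] by at most [d]. *)
apply: (subclosed_compact (B := `[- (B + d), B + d] `*` `[- (B + d), B + d])).
- exact: closed_net.
- by apply: compact_setX; exact: segment_compact.
have XM2 z : X z -> (- B <= z.1 <= B) /\ (- B <= z.2 <= B).
  by move=> /XM /=; rewrite [`|z|]prod_normE ge_max !ler_norml => /andP[].
move=> z nz; rewrite /= !in_itv /=; case: nz => [/XM2|]; first by have := d_gt0; lra.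
move=> [n [c [[_ [x [/XM2 xM xc]]] /frameP[zc _]]]].
have : h n <= d by exact: mesh_le.
by move: xc zc; rewrite !squareE; lra.
Qed.

(** * The Suslinian property of the net; [Q] is the set S of the opening idea *)

Let Q : set R := [set a | exists q : rat, a = d * ratr q].

Lemma grid_rational n : grid d n `<=` Q.
Proof.
move=> _ [k ->]; exists (k%:~R / 2 ^+ n).
by rewrite /mesh fmorph_div /= rmorphXn /= ratr_int ratr_nat; ring.
Qed.

Lemma countable_rational : countable (Q `*` Q).
Proof.
have -> : Q `*` Q = (fun q : rat * rat => (d * ratr q.1, d * ratr q.2)) @` setT.
  apply/seteqP; split=> [[_ _] [/= [q ->] [q' ->]]|]; first by exists (q, q').
  by move=> _ [[q q'] _ <-]; split; [exists q|exists q'].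
exact: card_le_trans (card_image_le _ _) (countableP _).
Qed.

(* Unqualified, [nondegenerate] is the notion for sesquilinear forms. *)
Lemma continuum_off_meets_rational (C : set (R * R)) :
  closed X -> connected C -> Defs.nondegenerate C ->
  C `<=` net -> ~ C `<=` X -> C `&` (Q `*` Q) !=set0.
Proof.
move=> clX cC [x [y [Cx Cy xy]]] Cnet /existsNP[p /not_implyP[Cp Xp]].
have [q Cq pq] : exists2 q, C q & p <> q.
  by have [<-|] := eqVneq x p; [exists y|move=> /eqP px; exists x => // /esym].
(* The ball also avoids [q], so that [C] cannot fit in a box inside the ball. *)
have /nbhs_ballP[r /= r0 pr] : nbhs p (~` (X `|` [set q])).
  apply: open_nbhs_nbhs; split; last by case.
  apply: closed_openC; apply: closedU => //.
  by apply: compact_closed; [exact: norm_hausdorff|exact: compact_set1].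
have [a1 Qa1 [a1p Ga1]] : exists2 a, Q a & p.1 - r < a < p.1 /\ forall n, ~ grid d n a.
  by apply: grid_dense => //; lra.
have [b1 Qb1 [b1p Gb1]] : exists2 a, Q a & p.1 < a < p.1 + r /\ forall n, ~ grid d n a.
  by apply: grid_dense => //; lra.
have [a2 Qa2 [a2p Ga2]] : exists2 a, Q a & p.2 - r < a < p.2 /\ forall n, ~ grid d n a.
  by apply: grid_dense => //; lra.
have [b2 Qb2 [b2p Gb2]] : exists2 a, Q a & p.2 < a < p.2 + r /\ forall n, ~ grid d n a.
  by apply: grid_dense => //; lra.
apply: contrapT => CQ.
have C_sub : C `<=` `]a1, b1[ `*` `]a2, b2[.
  apply: (connected_clopen_sub _ _ _ (`[a1, b1] `*` `[a2, b2]) cC).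
  - by apply: open_setX; exact: itv_open.
  - by apply: closed_setX; exact: itv_closed.
  - apply/seteqP; split=> z [Cz]; rewrite /= !in_itv /= => zab; split=> //; first by lra.
    have pz : ball p r z by rewrite ball_pairE !ltr_norml; lra.
    have [Xz|[n [c [[[gc1 gc2] _] /frameP[_ cz]]]]] := Cnet z Cz.
      by case: (pr z pz); left.
    (* One coordinate of [z] is in a grid, hence in [Q], and differs from the box sides, which are
       in no grid. The other is then outside [Q], as [C] misses [Q x Q], and differs from the sides,
       which are in [Q]. So [z] is not on the boundary of the box. *)
    have gz : grid d n z.1 \/ grid d n z.2.
      by case: cz => ->; [left|left|right|right] => //; exact: grid_succ.
    have Qz : ~ (Q z.1 /\ Q z.2) by move=> Qz; apply: CQ; exists z.
    have ne u v : Q u -> ~ Q v -> v != u.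
      by move=> Qu Qv; apply/eqP => vu; apply: Qv; rewrite vu.
    have gne u v : (forall n, ~ grid d n u) -> grid d n v -> v != u.
      by move=> gu gv; apply/eqP => vu; apply: (gu n); rewrite -vu.
    have : [/\ z.1 != a1, z.1 != b1, z.2 != a2 & z.2 != b2].
      case: gz => [g1|g2].
        have nQ2 : ~ Q z.2 by move=> Q2; apply: Qz; split=> //; exact: grid_rational g1.
        by split; [exact: gne|exact: gne|exact: ne|exact: ne].
      have nQ1 : ~ Q z.1 by move=> Q1; apply: Qz; split=> //; exact: grid_rational g2.
      by split; [exact: ne|exact: ne|exact: gne|exact: gne].
    by case; rewrite !neq_lt; lra.
  - by exists p; split=> //; rewrite /= !in_itv /=; lra.
have := C_sub q Cq; rewrite /= !in_itv /= => qab.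
case: (pr q); last by right.
by rewrite ball_pairE !ltr_norml; lra.
Qed.

Lemma suslinian_net : closed X -> suslinian X -> suslinian net.
Proof.
move=> clX sX F Fnet dF.
(* Members inside [X] are countably many because [X] is Suslinian; the others each hit the countable
   set [Q x Q]. *)
pose F' (b : bool) := [set C | F C /\ (C `<=` X <-> b)].
have -> : F = \bigcup_b F' b.
  apply/seteqP; split=> [C FC|C [b _ []//]].
  by have [CX|CX] := pselect (C `<=` X); [exists true|exists false].
apply: bigcup_countable => [|b _]; first exact: countableP.
case: b.
  apply: sX => [C [FC CX]|C D [FC _] [FD _]]; last exact: dF.
  by have [? ? _] := Fnet C FC; split=> //; apply/CX.
apply: (countable_disjoint_meeting _ (Q `*` Q)); first exact: countable_rational.
  move=> C [FC CX]; have [[_ _ cC] ndC Cn] := Fnet C FC.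
  by apply: continuum_off_meets_rational => // /CX.
by move=> C D [FC _] [FD _]; exact: dF.
Qed.

End Net.

(** * The one-point case and the conclusion *)

Lemma locally_connected_set1 (T : topologicalType) (x : T) :
  locally_connected_set [set x].
Proof.
move=> _ U -> /nbhs_singleton Ux; exists [set x]; split=> //.
- by move=> _ ->.
- exact: connected1.
by exists setT; [exact: openT|rewrite setIT].
Qed.

Theorem theorem6 (R : realType) (X : set (R * R)) :
  continuum X -> suslinian X ->
  exists X' : set (R * R),
    [/\ X `<=` X', continuum X', locally_connected_set X' & suslinian X'].
Proof.
move=> [[x Xx] kX cX] sX.
have [[y [Xy yx]]|X1] := pselect (exists y, X y /\ y <> x); last first.
  have XE : X = [set x].
    apply/seteqP; split=> [y Xy|_ ->//]; apply: contrapT => yx.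
    by apply: X1; exists y.
  exists X; split=> //; first by split=> //; exists x.
  by rewrite XE; exact: locally_connected_set1.
have clX : closed X by apply: compact_closed kX; exact: norm_hausdorff.
(* The norm is the maximum norm, so two points of a square of side at most [d] are at distance at
   most [d], less than that of [x] and [y]. *)
pose d := `|y - x| / 2.
have d_gt0 : 0 < d by rewrite divr_gt0 ?normr_gt0 ?subr_eq0//; apply/eqP.
have X_large c e : e <= d -> ~ X `<=` square c e.
  move=> ed XQ; have := XQ x Xx; have := XQ y Xy; rewrite !squareE => yc xc.
  suff : `|y - x| <= e by move: d_gt0 ed; rewrite /d; lra.
  by rewrite [`|_|]prod_normE ge_max !ler_norml /=; lra.
exists (net d X); split.
- by left.
- split; [by exists x; left|exact: compact_net|].
  by apply: connected_net => //; exists x.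
- exact: locally_connected_net.
- exact: suslinian_net.
Qed.
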